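(* Let $(a_k)_{k\in\mathbb{N}}$ be a sequence with $a_k>0$ for all $k\in\mathbb{N}$, and let $\check{\mathcal{E}}$, with domain $\check{\mathcal{D}}$, be the trace of the Bessel Dirichlet form $\mathcal{E}$ (case $n=3$) with respect to $\mu=\sum_{k\in\mathbb{N}}a_k\delta_k$. Then there is a finite constant $c>0$ such that $$|u_k|\le\frac{c}{k^{1/2}}\,(\check{\mathcal{E}}[u])^{1/2}\qquad\text{for all } k\in\mathbb{N}\text{ and all } u=(u_k)\in\check{\mathcal{D}} .$$
   Context: $\mathbb{N}=\{1,2,\dots\}$ and $I=(0,\infty)$; $AC(I)$ denotes the (locally) absolutely continuous functions on $I$. Let $dm=2x^2\,dx$ on $I$. The Bessel Dirichlet form (case $n=3$) is the form in $L^2(I,m)$ with $$\mathcal{D}=\{u\in AC(I)\cap L^2(I,m):\ \int_0^\infty (u')^2x^2\,dx<\infty\},\qquad \mathcal{E}[u]=\int_0^\infty (u'(x))^2x^2\,dx .$$ For $\lambda>0$, $\mathcal{E}_\lambda[u]=\mathcal{E}[u]+\lambda\int_I u^2\,dm$. Trace with respect to $\mu=\sum_{k\in\mathbb{N}}a_k\delta_k$: $\ell^2(\mathbb{N},\mu)=L^2(\mathbb{N},\mu)$ is the space of real sequences with $\sum_k a_ku_k^2<\infty$. Let $D(J)=\{u\in\mathcal{D}:\sum_{k}a_ku(k)^2<\infty\}$ and $J:D(J)\to\ell^2(\mathbb{N},\mu)$, $Ju=u|_{\mathbb{N}}$. For $\lambda>0$ let $P_\lambda$ be the orthogonal projection in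 $(\mathcal{D},\mathcal{E}_\lambda)$ onto the $\mathcal{E}_\lambda$-orthogonal complement of $\ker J=\{u\in\mathcal{D}:u(k)=0\ \forall k\in\mathbb{N}\}$, and set $\check{\mathcal{E}}_\lambda[Ju]:=\mathcal{E}_\lambda[P_\lambda u]$ for $u\in D(J)$. Each $\check{\mathcal{E}}_\lambda$ is a closed form in $\ell^2(\mathbb{N},\mu)$ with domain $\operatorname{ran}J$, and the family is monotone increasing in $\lambda$. The trace form $\check{\mathcal{E}}$ is by definition the Mosco limit of $\check{\mathcal{E}}_\lambda$ as $\lambda\downarrow0$. *)

(* Defs.v *)
From HB Require Import structures.
From mathcomp Require Import all_boot all_order all_algebra.
From mathcomp Require Import all_classical all_reals all_analysis.

Set Implicit Arguments.
Unset Strict Implicit.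
Unset Printing Implicit Defensive.

Import Order.TTheory GRing.Theory Num.Theory.
Import numFieldNormedType.Exports.

Local Open Scope classical_set_scope.
Local Open Scope ring_scope.

(* Conventions.
   - N = {1, 2, ...}: a real sequence indexed by N is a function nat -> R whose
     value at k is the term of index k.+1.
   - A function on I = (0, +oo) is a function R -> R, of which only the values on
     I matter; elements of L^2(I, m) that are locally absolutely continuous are
     represented by their continuous version.
   - A quadratic form is extended by +oo outside of its domain. *)

Section AbsoluteContinuity.
Context {R : realType}.

Definition abs_continuous (a b : R) (u : R -> R) : Prop :=
  forall e : R, 0 < e -> exists2 d : R, 0 < d &
    forall (n : nat) (x y : 'I_n -> R),
      (forall i, [/\ a <= x i, x i <= y i & y i <= b]) ->
      trivIset [set: 'I_n] (fun i => [set` `]x i, y i[]) ->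
      \sum_(i < n) (y i - x i) < d ->
      \sum_(i < n) `|u (y i) - u (x i)| < e.

Definition loc_abs_continuous (u : R -> R) : Prop :=
  forall a b : R, 0 < a -> a <= b -> abs_continuous a b u.

End AbsoluteContinuity.

Section BesselForm.
Context {R : realType}.
Local Notation leb := (@lebesgue_measure R).

Definition halfline : set R := [set` `]0, +oo[].

(* \int_I f dm with dm = 2 x^2 dx *)
Definition integral_m (f : R -> R) : \bar R :=
  (\int[leb]_(x in halfline) (f x * (2 * x ^+ 2))%:E)%E.

Definition L2m (u : R -> R) : Prop :=
  measurable_fun halfline u /\ (integral_m (fun x => u x ^+ 2)%R < +oo)%E.

(* [derive1 u x] is the classical derivative; a locally absolutely continuous
   function is derivable almost everywhere, and the value of [derive1] at the
   remaining points is irrelevant to the integrals. *)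
Definition bessel_energy (u : R -> R) : \bar R :=
  (\int[leb]_(x in halfline) (derive1 u x ^+ 2 * x ^+ 2)%:E)%E.

Definition bessel_dom : set (R -> R) :=
  [set u | [/\ loc_abs_continuous u, L2m u & (bessel_energy u < +oo)%E]].

Definition bessel_energy_lam (lam : R) (u : R -> R) : \bar R :=
  (bessel_energy u + lam%:E * integral_m (fun x => u x ^+ 2)%R)%E.

(* The symmetric bilinear form of [bessel_energy_lam lam]; both integrands are
   integrable when u and v are in [bessel_dom]. *)
Definition bessel_inner_lam (lam : R) (u v : R -> R) : \bar R :=
  (\int[leb]_(x in halfline) (derive1 u x * derive1 v x * x ^+ 2)%:E +
   lam%:E * integral_m (fun x => u x * v x)%R)%E.

End BesselForm.

Section WeightedL2.
Context {R : realType}.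
Variable a : nat -> R.

Definition norm2 (u : nat -> R) : \bar R :=
  (\sum_(0 <= k <oo) (a k * u k ^+ 2)%:E)%E.

Definition l2 : set (nat -> R) := [set u | (norm2 u < +oo)%E].

(* the series converges absolutely for u, v in l2 *)
Definition l2_inner (u v : nat -> R) : R :=
  limn (series (fun k => a k * u k * v k)).

Definition l2_strong_cvg (un : nat -> nat -> R) (u : nat -> R) : Prop :=
  norm2 (fun k => un n k - u k) @[n --> \oo] --> 0%E.

Definition l2_weak_cvg (un : nat -> nat -> R) (u : nat -> R) : Prop :=
  forall v, l2 v -> l2_inner (un n) v @[n --> \oo] --> l2_inner u v.

(* F is the Mosco limit in l2 of the forms F_ lam as lam decreases to 0. *)
Definition is_mosco_limit0 (F_ : R -> (nat -> R) -> \bar R)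
    (F : (nat -> R) -> \bar R) : Prop :=
  forall lam : nat -> R, (forall n, 0 < lam n) -> lam n @[n --> \oo] --> (0 : R) ->
    (forall (un : nat -> nat -> R) (u : nat -> R),
       (forall n, l2 (un n)) -> l2 u -> l2_weak_cvg un u ->
       (F u <= limn_einf (fun n => F_ (lam n) (un n)))%E) /\
    (forall u : nat -> R, l2 u ->
       exists un : nat -> nat -> R,
         [/\ forall n, l2 (un n), l2_strong_cvg un u &
             (limn_esup (fun n => F_ (lam n) (un n)) <= F u)%E]).

End WeightedL2.

Section Trace.
Context {R : realType}.
Variable a : nat -> R.

Definition restrN (u : R -> R) : nat -> R := fun k => u k.+1%:R.

Definition dom_J : set (R -> R) :=
  [set u | bessel_dom u /\ l2 a (restrN u)].

Definition ker_J : set (R -> R) :=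
  [set u | bessel_dom u /\ forall k, restrN u k = 0].

(* v = P_lam u *)
Definition is_proj_ker_J_compl (lam : R) (u v : R -> R) : Prop :=
  [/\ bessel_dom v,
      (forall w, ker_J w -> bessel_inner_lam lam v w = 0%E) &
      ker_J (fun x => u x - v x)].

(* The set below is the singleton { E_lam[P_lam u] } if s = J u for some u in
   dom_J, and is empty, with infimum +oo, if s is not in the range of J. *)
Definition trace_form_lam (lam : R) (s : nat -> R) : \bar R :=
  ereal_inf [set e | exists u v : R -> R,
    [/\ dom_J u, restrN u = s, is_proj_ker_J_compl lam u v &
        e = bessel_energy_lam lam v]].

Definition is_trace_form (F : (nat -> R) -> \bar R) : Prop :=
  is_mosco_limit0 a trace_form_lam F.

Definition form_dom (F : (nat -> R) -> \bar R) : set (nat -> R) :=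
  [set u | l2 a u /\ (F u < +oo)%E].

End Trace.

(* Main.v *)
Require Import Defs.
From HB Require Import structures.
From mathcomp Require Import all_boot all_order all_algebra.
From mathcomp Require Import all_classical all_reals all_analysis.
From mathcomp Require Import measurable_realfun.
From mathcomp Require Import ring lra.
Set Implicit Arguments.
Unset Strict Implicit.
Unset Printing Implicit Defensive.
Import Order.TTheory GRing.Theory Num.Theory.
Import numFieldNormedType.Exports.
Local Open Scope classical_set_scope.
Local Open Scope ring_scope.

(** The constant is c = 1. The heart of the matter is the radial bound
    |v x| <= sqrt (E[v]) / sqrt x for v in the Bessel form domain and x > 0
    ([bessel_dom_bound]). For x < b,
    |v x - v b| <= \int_x^b |v' y| y * y^-1 dy
                <= (\int_x^b v' y ^ 2 y ^ 2 dy)^(1/2) * (1/x - 1/b)^(1/2),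
    and v b is arbitrarily small for suitable large b because v is in L^2(m).

    The bound passes to the trace. A finite value of the form E_lam-check at a
    sequence s is the E_lam-energy of a function v of the form domain with
    v k = s_k for all positive integers k, and the energy of v is at most its
    E_lam-energy; so |s_k| <= k^(-1/2) * E_lam-check[s]^(1/2), uniformly in lam
    ([trace_form_lam_bound]). For u in the domain of the Mosco limit, a recovery
    sequence converges to u in l^2, hence at each coordinate as the weights are
    positive, and its energies are eventually below any number above E[u].

    The energy is written with the classical derivative, so the first step rests
    on the fundamental theorem of calculus for absolutely continuous functions
    ([abs_continuous_primitive], [derive1_primitive_ae]). An absolutely continuous
    u is a difference of two nondecreasing absolutely continuous functions, its
    variation function V and V - u. The Stieltjes measure of such a function is
    dominated by the Lebesgue measure ([lebesgue_stieltjes_dominated]), so it has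
    a Radon-Nikodym density f; then u is a primitive of f, and u' = f almost
    everywhere by Lebesgue differentiation. *)

(** * Absolute continuity controls total variations *)

Section IntervalFamilies.
Context {R : realType}.
Implicit Types (a b : R) (u : R -> R) (p q : R * R) (s : seq (R * R)).

(** Disjointness of the open intervals as sets, so that a degenerate interval
    ]x, x[ overlaps nothing, wherever x lies. *)
Definition nonoverlapping p q : bool :=
  `[< [set` `]p.1, p.2[] `&` [set` `]q.1, q.2[] = set0 >].

(** Families of intervals are lists here, which can be cut, concatenated and
    refined, instead of functions on 'I_n. *)
Definition interval_family a b s : bool :=
  all (fun p => [&& a <= p.1, p.1 <= p.2 & p.2 <= b]) s &&
  pairwise nonoverlapping s.

Definition family_length s : R := \sum_(p <- s) (p.2 - p.1).

Definition family_variation u s : R := \sum_(p <- s) `|u p.2 - u p.1|.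

Lemma abs_continuous_family a b u : abs_continuous a b u ->
  forall e, 0 < e -> exists2 d, 0 < d &
    forall s, interval_family a b s -> family_length s < d ->
      family_variation u s < e.
Proof.
move=> acu e /acu[d d0 H]; exists d => // s /andP[/allP sab dis].
pose x i := (nth (0, 0) s i).1; pose y i := (nth (0, 0) s i).2.
rewrite /family_length /family_variation !(big_nth (0, 0)) !big_mkord.
apply: (H (size s) (fun i => x i) (fun i => y i)) => [i|].
  by have /and3P[? ? ?] := sab _ (mem_nth (0, 0) (ltn_ord i)); split.
have lt_dis (i j : 'I_(size s)) : (i < j)%N ->
    [set` `]x i, y i[] `&` [set` `]x j, y j[] = set0.
  move=> ij.
  by have /asboolP := pairwiseP (0, 0) dis _ _ (ltn_ord i) (ltn_ord j) ij.
move=> i j _ _ [z [zi zj]]; apply/val_inj/eqP => /=.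
have noz (k l : 'I_(size s)) : (k < l)%N ->
    z \in `]x k, y k[ -> z \in `]x l, y l[ -> False.
  by move=> /lt_dis/seteqP[+ _] zk zl => /(_ z); apply; split.
by have [/noz|/noz|//] := ltngtP i j; case.
Qed.

Lemma nonoverlapping_subr p q r : q.1 <= r.1 -> r.2 <= q.2 ->
  nonoverlapping p q -> nonoverlapping p r.
Proof.
move=> q1 q2 /asboolP pq; apply/asboolP/seteqP; split=> // z [zp zr].
move: pq => /seteqP[+ _] => /(_ z); apply; split=> //=.
by move: zr; rewrite /= !in_itv/= => /andP[? ?]; apply/andP; split; lra.
Qed.

Lemma nonoverlappingC p q : nonoverlapping p q = nonoverlapping q p.
Proof. by rewrite /nonoverlapping setIC. Qed.

Lemma nonoverlapping_le p q : p.2 <= q.1 -> nonoverlapping p q.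
Proof.
move=> pq; apply/asboolP/seteqP; split=> // z [/=].
by rewrite !in_itv/= => /andP[? ?] /andP[? ?]; lra.
Qed.

Definition consecutive x (l : seq R) : seq (R * R) := zip (x :: l) l.

Lemma consecutive_within x l : path <%R x l ->
  all (fun p => [&& x <= p.1, p.1 <= p.2 & p.2 <= last x l]) (consecutive x l).
Proof.
elim: l x => //= y l IH x /andP[xy yl]; rewrite /consecutive/= lexx (ltW xy)/=.
have yll : y <= last y l by exact: (@itv_partition_le _ _ _ _ l).
rewrite yll/=; apply: sub_all (IH _ yl) => p /and3P[yp -> ->].
by rewrite (le_trans (ltW xy) yp).
Qed.

Lemma consecutive_family x l : path <%R x l ->
  interval_family x (last x l) (consecutive x l).
Proof.
move=> xl; apply/andP; split; first exact: consecutive_within.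
elim: l x xl => //= y l IH x /andP[xy yl].
rewrite /consecutive/= -/(consecutive y l) IH// andbT.
apply: sub_all (consecutive_within yl) => p /and3P[yp _ _].
exact: nonoverlapping_le.
Qed.

Lemma consecutive_length x l : family_length (consecutive x l) = last x l - x.
Proof.
rewrite /family_length; elim: l x => [x|y l IH x] /=; first by rewrite big_nil subrr.
by rewrite /consecutive/= big_cons -/(consecutive y l) IH/=; lra.
Qed.

Lemma variation_consecutive x y u l : itv_partition x y l ->
  variation x y u l = family_variation u (consecutive x l).
Proof.
move=> xyl; rewrite variation_zip// /family_variation /consecutive {xyl}.
by elim: l x => [x|z l IH x] /=; rewrite ?big_nil// !big_cons IH/= .
Qed.

(** An interval of a family may be replaced by any family inside it: overlap with
    the other intervals can only decrease. *)
Lemma family_refine a b s1 s2 p s : interval_family a b (s1 ++ p :: s2) ->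
  interval_family p.1 p.2 s -> interval_family a b (s1 ++ s ++ s2).
Proof.
rewrite /interval_family !all_cat !pairwise_cat/= !allrel_catr !allrel_consr.
move=> /andP[/and3P[-> /and3P[ap pp pb] -> /=]].
move=> /and4P[/andP[/allP s1p ->] -> /allP ps2 ->] /andP[/allP sp ->] /=.
rewrite !andbT; apply/and3P; split.
- apply/allP => q /sp /and3P[? ? ?]; apply/and3P; split=> //; lra.
- apply/allrelP => q r /s1p /= qp /sp /and3P[? ? ?].
  exact: nonoverlapping_subr qp.
- apply/allrelP => r q /sp /and3P[? ? ?] /ps2 /=.
  rewrite nonoverlappingC => qp; rewrite nonoverlappingC.
  exact: nonoverlapping_subr qp.
Qed.

(** Absolute continuity bounds sums of increments; it then bounds sums of total
    variations, because a partition of one interval of a family refines the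
    family without changing its length. The intervals of s are traded one at a
    time, from the last, for arbitrary partitions, which accumulate in s2; the
    total variation of the interval is the supremum over these partitions. *)
Lemma family_total_variation_le a b u d e :
  (forall s, interval_family a b s -> family_length s < d ->
     family_variation u s <= e) ->
  forall s s2, interval_family a b (s ++ s2) -> family_length (s ++ s2) < d ->
  (\sum_(p <- s) total_variation p.1 p.2 u + (family_variation u s2)%:E <= e%:E)%E.
Proof.
move=> H s; elim/last_ind: s => [s2 ? ?|s p IH s2].
  by rewrite big_nil add0e lee_fin H.
rewrite cat_rcons => fam len.
have [_ /andP[pp _]] : a <= p.1 /\ (p.1 <= p.2) && (p.2 <= b).
  by move: fam => /andP[+ _]; rewrite all_cat/= => /andP[_ /andP[/and3P[? -> ->]]].
have refine l : itv_partition p.1 p.2 l ->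
    (\sum_(q <- s) total_variation q.1 q.2 u + (variation p.1 p.2 u l)%:E +
      (family_variation u s2)%:E <= e%:E)%E.
  move=> /[dup] pl [pathl /eqP lastl].
  rewrite -addeA -EFinD variation_consecutive//.
  rewrite /family_variation -big_cat/=; apply: IH.
    apply: family_refine fam _.
    by rewrite -[in X in interval_family _ X]lastl; exact: consecutive_family.
  move: len; rewrite /family_length !big_cat/= !big_cons.
  by rewrite -!/(family_length _) consecutive_length lastl.
set T := (\sum_(q <- s) _)%E in refine *.
have T0 : (0 <= T)%E.
  rewrite /T big_seq; apply: sume_ge0 => q qs; apply: total_variation_ge0.
  by move: fam => /andP[]; rewrite all_cat => /andP[/allP/(_ _ qs)/and3P[]].
have [l0 pl0] : exists l, itv_partition p.1 p.2 l.
  move: pp; rewrite le_eqVlt => /predU1P[->|/itv_partition1 ?]; last by exists [:: p.2].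
  by exists [::]; split=> /=.
have Tfin : T \is a fin_num.
  rewrite ge0_fin_numE//; have := refine _ pl0.
  by move: T0; case: T {refine} => [t| |] //= _; rewrite ?ltry// ?addye//.
rewrite -cats1 big_cat/= big_seq1 addeAC -/T -leeBrDl ?fin_numD ?Tfin//.
apply: ge_ereal_sup => _ [_ [l pl <-] <-].
by rewrite leeBrDl ?fin_numD ?Tfin// addeAC refine.
Qed.

Lemma abs_continuous_total_variation a b u : abs_continuous a b u ->
  forall e, 0 < e -> exists2 d, 0 < d &
    forall s, interval_family a b s -> family_length s < d ->
      (\sum_(p <- s) total_variation p.1 p.2 u <= e%:E)%E.
Proof.
move=> /abs_continuous_family acu e /acu[d d0 H]; exists d => // s fs ls.
rewrite -[leLHS]adde0 -[X in (_ + X)%E](_ : (family_variation u [::])%:E = _)%E.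
  apply: (family_total_variation_le (a := a) (b := b) (d := d)); rewrite ?cats0//.
  by move=> s' ? ?; exact/ltW/H.
by rewrite /family_variation big_nil.
Qed.

(** Intervals shorter than the d that absolute continuity gives for e = 1 have
    total variation at most 1, and finitely many of them cover [x, y]. *)
Lemma abs_continuous_total_variation_fin a b u : abs_continuous a b u ->
  forall x y, a <= x -> x <= y -> y <= b -> total_variation x y u \is a fin_num.
Proof.
move=> /abs_continuous_total_variation /(_ 1 ltr01)[d d0 H] x y ax xy yb.
have short z w : a <= z -> z <= w -> w <= b -> w - z < d ->
    (total_variation z w u < +oo)%E.
  move=> az zw wb wzd; have := H [:: (z, w)]; rewrite /interval_family/= az zw wb/=.
  by rewrite /family_length !big_seq1/= => /(_ isT wzd)/le_lt_trans; apply; exact: ltry.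
rewrite ge0_fin_numE ?total_variation_ge0//.
(* induction on the number n of steps of length d / 2 from x to z *)
have main n z : x <= z -> z <= y -> z - x <= n%:R * (d / 2) ->
    (total_variation x z u < +oo)%E.
  elim: n z => [|n IH] z xz zy zx.
    have -> : z = x by move: zx; rewrite mul0r; lra.
    by rewrite total_variationxx.
  pose w := Num.max x (z - d / 2).
  have xw : x <= w by rewrite le_max lexx.
  have wz : w <= z by rewrite ge_max xz/=; lra.
  rewrite (total_variationD _ xw wz) lte_add_pinfty//.
    apply: IH => //; first lra.
    have n0 : 0 <= n%:R * (d / 2) by rewrite mulr_ge0//; lra.
    rewrite /w lerBlDr ge_max; move: zx; rewrite -natr1 mulrDl mul1r.
    by move=> zx; apply/andP; split; lra.
  apply: short; [lra|by []|lra|].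
  have : z - d / 2 <= w by rewrite le_max lexx orbT.
  lra.
have [n yn] : exists n : nat, (y - x) / (d / 2) <= n%:R.
  by exists (Num.truncn ((y - x) / (d / 2))).+1; exact/ltW/truncnS_gt.
by apply: (main n) => //; rewrite -ler_pdivrMr//; lra.
Qed.
End IntervalFamilies.

(** * Nondecreasing absolutely continuous functions *)

Section NondecreasingAC.
Context {R : realType}.
Implicit Types (a b : R) (u g : R -> R) (p q : R * R) (s : seq (R * R)).

(** Absolute continuity on the whole line for nondecreasing functions, whose
    increments need no absolute values. *)
Definition nondecreasing_ac g : Prop :=
  forall e, 0 < e -> exists2 d, 0 < d & forall s,
    all (fun p => p.1 <= p.2) s -> pairwise nonoverlapping s ->
    family_length s < d -> \sum_(p <- s) (g p.2 - g p.1) <= e.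

Definition clamp a b x : R := Num.max a (Num.min b x).

Lemma clamp_bounds a b x : a <= b -> a <= clamp a b x <= b.
Proof. by move=> ab; rewrite /clamp le_max lexx/= ge_max ab/= ge_min lexx. Qed.

Lemma clamp_id a b x : a <= x -> x <= b -> clamp a b x = x.
Proof. by move=> ax xb; rewrite /clamp (min_idPr xb) (max_idPr ax). Qed.

Lemma clamp_nondecreasing a b x y : x <= y -> clamp a b x <= clamp a b y.
Proof.
rewrite /clamp /Num.max /Num.min => xy.
by do !case: ifP => //; lra.
Qed.

Lemma clamp_length a b x y : a <= b -> x <= y ->
  clamp a b y - clamp a b x <= y - x.
Proof.
rewrite /clamp /Num.max /Num.min => ab xy.
by do !case: ifP => //; lra.
Qed.

(** The open interval between clamp a b x and clamp a b y is contained in ]x, y[. *)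
Lemma clamp_nonoverlapping a b p q : a <= b -> nonoverlapping p q ->
  nonoverlapping (clamp a b p.1, clamp a b p.2) (clamp a b q.1, clamp a b q.2).
Proof.
move=> ab /asboolP pq; apply/asboolP/seteqP; split=> // z [].
have itv (r : R * R) : z \in `]clamp a b r.1, clamp a b r.2[ -> z \in `]r.1, r.2[.
  rewrite !in_itv/= /clamp /Num.max /Num.min => /andP[].
  by do !case: ifP => //; move=> *; apply/andP; split; lra.
move=> /itv zp /itv zq; move: pq => /seteqP[+ _] => /(_ z); apply; split=> //.
Qed.

Lemma clamp_family a b s : a <= b -> all (fun p => p.1 <= p.2) s ->
  pairwise nonoverlapping s ->
  interval_family a b [seq (clamp a b p.1, clamp a b p.2) | p <- s].
Proof.
move=> ab /allP sp dis; apply/andP; split.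
  apply/allP => _ /mapP[p ps ->]/=.
  have /andP[-> _] := clamp_bounds p.1 ab; have /andP[_ ->] := clamp_bounds p.2 ab.
  by rewrite clamp_nondecreasing// sp.
rewrite pairwise_map; apply: sub_pairwise dis => p q /=.
exact: clamp_nonoverlapping.
Qed.

(** Clamping makes the variation function constant outside [a, b]: it becomes a
    nondecreasing function on the line, which defines a Stieltjes measure. *)
Definition clamped_variation a b u x : R := fine (total_variation a (clamp a b x) u).

Section clamped.
Variables (a b : R) (u : R -> R).
Hypotheses (ab : a <= b) (acu : abs_continuous a b u).
Let V := clamped_variation a b u.

Lemma clamped_variationB x y : x <= y ->
  V y - V x = fine (total_variation (clamp a b x) (clamp a b y) u).
Proof.
move=> /(clamp_nondecreasing a b) xy.
have /andP[ax xb] := clamp_bounds x ab; have /andP[ay yb] := clamp_bounds y ab.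
rewrite /V /clamped_variation (total_variationD u ax xy) fineD.
- by rewrite addrC addKr.
- exact: (abs_continuous_total_variation_fin acu).
- exact: (abs_continuous_total_variation_fin acu).
Qed.

Lemma clamped_variation_nondecreasing x y : x <= y -> V x <= V y.
Proof.
move=> xy; rewrite -subr_ge0 clamped_variationB// fine_ge0// total_variation_ge0//.
exact: clamp_nondecreasing.
Qed.

Lemma clamped_variation_dominates x y : x <= y ->
  `|u (clamp a b y) - u (clamp a b x)| <= V y - V x.
Proof.
move=> /[dup] /(clamp_nondecreasing a b) cxy xy.
rewrite clamped_variationB// -lee_fin fineK ?total_variation_ge//.
have /andP[ax xb] := clamp_bounds x ab; have /andP[ay yb] := clamp_bounds y ab.
exact: (abs_continuous_total_variation_fin acu).
Qed.

Lemma clamped_variation_ac : nondecreasing_ac V.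
Proof.
move=> e /(abs_continuous_total_variation acu)[d d0 H]; exists d => // s sp dis sd.
have := H _ (clamp_family ab sp dis); rewrite /family_length !big_map/=.
move=> hs; rewrite -lee_fin; apply: le_trans (hs _).
  rewrite -sumEFin !big_seq; apply: lee_sum => p ps.
  have pp := allP sp _ ps.
  rewrite clamped_variationB// fineK//.
  have /andP[ax xb] := clamp_bounds p.1 ab; have /andP[ay yb] := clamp_bounds p.2 ab.
  apply: (abs_continuous_total_variation_fin acu) => //.
  exact: clamp_nondecreasing.
apply: le_lt_trans sd; rewrite /family_length !big_seq; apply: ler_sum => p ps.
by apply: clamp_length => //; exact: (allP sp).
Qed.
End clamped.

Lemma nondecreasing_ac_continuous g : {homo g : x y / x <= y} ->
  nondecreasing_ac g -> continuous g.
Proof.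
move=> ndg acg x; apply/cvgrPdist_le => e /acg[d d0 H].
near=> y.
have short z w : z <= w -> w - z < d -> g w - g z <= e.
  move=> zw wz; have := H [:: (z, w)]; rewrite /= /family_length !big_seq1/= zw.
  by apply.
have xyd : `|x - y| < d by near: y; exact: cvgr_dist_lt.
have [xy|/ltW yx] := leP x y.
  rewrite distrC ger0_norm ?subr_ge0 ?ndg// short//.
  by move: xyd; rewrite distrC ger0_norm ?subr_ge0.
rewrite ger0_norm ?subr_ge0 ?ndg// short//.
by move: xyd; rewrite ger0_norm ?subr_ge0.
Unshelve. all: by end_near. Qed.

End NondecreasingAC.

(** * The density of a nondecreasing absolutely continuous function *)

Section StieltjesDensity.
Context {R : realType}.
Implicit Types (a b : R) (p : R * R).
Local Notation leb := (@lebesgue_measure R).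

Lemma open_interval_of_finite_length (I : set R) :
  open I -> is_interval I -> (leb I < +oo)%E ->
  exists p, p.1 <= p.2 /\ I = [set` `]p.1, p.2[].
Proof.
have empty : exists p, p.1 <= p.2 /\ (set0 : set R) = [set` `]p.1, p.2[].
  by exists (0, 0); split=> //=; rewrite set_itvoo0.
move=> oI /is_intervalP iI; move: oI; rewrite iI; case: (Rhull I) => i j oI.
rewrite lebesgue_measure_itv.
have [ij|ji _] := boolP (i < j)%O; last first.
  rewrite (_ : [set` _] = set0)//; apply/seteqP; split=> // x /=.
  by rewrite itv_ge.
move: i j oI ij => [bi x|[|]] [bj y|[|]]//= oI; rewrite ?ltxx//=.
- move=> xy _; have {}xy : x <= y.
    by move: xy {oI}; case: bi bj => -[]; rewrite bnd_simp => // /ltW.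
  exists (x, y); split=> //=; move/interior_id : oI => <-.
  by rewrite interior_itv_bnd.
- by rewrite ltry.
- by rewrite ltNyr.
Qed.

Lemma lebesgue_stieltjes_measure_oc (g : cumulative R R) x y : x <= y ->
  lebesgue_stieltjes_measure g [set` `]x, y]] = (g y - g x)%:E.
Proof.
move=> xy; rewrite /lebesgue_stieltjes_measure/= /measure_extension/=.
rewrite measurable_mu_extE//; last exact: is_ocitv.
exact: wlength_itv_bnd.
Qed.

(** A Lebesgue null set lies in an open set U of small length. U is a countable
    disjoint union of open intervals, so absolute continuity of g bounds the
    Stieltjes measure of finitely many of them uniformly, hence that of U. *)
Lemma lebesgue_stieltjes_dominated (g : cumulative R R) :
  nondecreasing_ac g -> lebesgue_stieltjes_measure g `<< leb.
Proof.
move=> acg; apply/null_content_dominatesP => A mA A0.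
apply/eqP; rewrite eq_le measure_ge0 andbT; apply/lee_addgt0Pr => e e0.
rewrite add0e; have [d d0 H] := acg _ e0.
have [|U [oU AU UA]] := lebesgue_regularity_outer mA _ d0.
  by rewrite A0 ltry.
have mU : measurable (U : set (measurableTypeR R)) by exact: open_measurable.
have Ud : (leb U < d%:E)%E.
  apply: le_lt_trans UA; rewrite -[leRHS]adde0 -A0.
  rewrite -[X in leb X](setDUK AU) setUC.
  by apply: measureU2 => //; exact: measurableD.
pose I := open_disjoint_itv oU.
have UE : U = \bigcup_q I q by exact: open_disjoint_itv_bigcup.
have IU q : I q `<=` U by rewrite UE; exact: bigcup_sup.
have mI q : measurable (I q : set (measurableTypeR R)).
  by apply: open_measurable; exact: open_disjoint_itv_open.
have tI : trivIset setT I by exact: open_disjoint_itv_trivIset.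
have /choice[p pI] q : exists p, p.1 <= p.2 /\ I q = [set` `]p.1, p.2[].
  apply: open_interval_of_finite_length.
  - exact: open_disjoint_itv_open.
  - exact: open_disjoint_itv_is_interval.
  - apply: (@le_lt_trans _ _ (leb U)); first by rewrite le_measure ?inE.
    by rewrite (lt_trans Ud) ?ltry.
have lebI q : leb (I q) = ((p q).2 - (p q).1)%:E.
  have [pq ->] := pI q; rewrite lebesgue_measure_itv/= lte_fin.
  by case: ltP => // qp; congr EFin; lra.
have muI q : (lebesgue_stieltjes_measure g (I q) <= (g (p q).2 - g (p q).1)%R%:E)%E.
  have [pq IE] := pI q; rewrite -lebesgue_stieltjes_measure_oc//.
  rewrite le_measure ?inE// IE; exact: subset_itv_oo_oc.
apply: (@le_trans _ _ (lebesgue_stieltjes_measure g U)).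
  by rewrite le_measure ?inE.
rewrite [X in lebesgue_stieltjes_measure g X]UE measure_bigcup//=.
apply: lime_le; first exact: is_cvg_nneseries.
near=> n; apply: (@le_trans _ _ (\sum_(0 <= q < n) (g (p q).2 - g (p q).1)%R%:E)%E).
  by rewrite big_mkcond/=; apply: lee_sum => q _; rewrite mem_set.
rewrite sumEFin lee_fin.
have := H [seq p q | q <- index_iota 0 n]; rewrite /family_length !big_map; apply.
- by apply/allP => _ /mapP[q _ ->]; have [] := pI q.
- rewrite pairwise_map; apply/(pairwiseP 0%N) => i j.
  rewrite !inE !size_iota subn0 => ilt jlt ij.
  rewrite /= /index_iota !nth_iota ?subn0// !add0n.
  rewrite /nonoverlapping -(pI i).2 -(pI j).2.
  rewrite (_ : I i `&` I j = set0)//.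
  by move/trivIsetP : tI; apply => //; rewrite ltn_eqF.
- rewrite -lte_fin -sumEFin; under eq_bigr do rewrite -lebI.
  rewrite big_mkord -(measure_bigsetU leb mI)//.
  apply: le_lt_trans Ud; rewrite le_measure ?inE//; first exact: bigsetU_measurable.
  by rewrite UE; exact: bigsetU_bigcup.
Unshelve. all: by end_near. Qed.

(** The density is the Radon-Nikodym derivative of the Stieltjes measure of g,
    restricted to ]a, b] to make it finite. *)
Lemma nondecreasing_ac_density (g : R -> R) a b : a <= b ->
  {homo g : x y / x <= y} -> nondecreasing_ac g ->
  exists2 f : R -> R, leb.-integrable setT (EFin \o f) &
    forall x, a <= x -> x <= b ->
      g x - g a = (\int[leb]_(t in [set` `[a, x]]) f t)%R.
Proof.
move=> ab ndg acg.
have rcg : forall x, g @ at_right x --> g x.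
  by apply: right_continuousW => x; exact: nondecreasing_ac_continuous.
pose G : cumulative R R := HB.pack g (isCumulative.Build R _ R g ndg rcg).
have acG : nondecreasing_ac G by [].
pose D : set (measurableTypeR R) := [set` `]a, b]].
have mD : measurable D by exact: measurable_itv.
have GD : (lebesgue_stieltjes_measure G D < +oo)%E.
  by rewrite lebesgue_stieltjes_measure_oc// ltry.
pose nu : {finite_measure set (measurableTypeR R) -> \bar R} := mfrestr mD GD.
have numu : nu `<< leb.
  apply/null_content_dominatesP => A mA A0.
  have /null_content_dominatesP := lebesgue_stieltjes_dominated acG; apply.
    exact: measurableI.
  apply/eqP; rewrite eq_le measure_ge0 andbT -A0 le_measure ?inE//; exact: measurableI.
pose f := Radon_Nikodym_SigmaFinite.f nu leb.
have ffin x : f x \is a fin_num by exact: Radon_Nikodym_SigmaFinite.f_fin_num.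
have fE : EFin \o (fine \o f) = f by apply/funext => x /=; rewrite fineK.
exists (fine \o f).
  by rewrite fE; exact: Radon_Nikodym_SigmaFinite.f_integrable.
move=> x ax xb.
rewrite /Rintegral (_ : (\int[leb]_(t in _) _)%E = nu [set` `[a, x]]); last first.
  rewrite (Radon_Nikodym_SigmaFinite.f_integral numu (measurable_itv `[a, x])).
  by apply: eq_integral => t _ /=; rewrite fineK.
rewrite /nu/= /mfrestr /mrestr (_ : _ `&` D = [set` `]a, x]]).
  by rewrite lebesgue_stieltjes_measure_oc.
apply/seteqP; split=> y /=; rewrite /D /= !in_itv/=.
  by move=> [/andP[_ ->] /andP[-> _]].
by move=> /andP[ay yx]; rewrite ay yx (ltW ay) (le_trans yx xb).
Qed.

End StieltjesDensity.

(** * The fundamental theorem of calculus for absolutely continuous functions *)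

Section FundamentalTheorem.
Context {R : realType}.
Implicit Types (a b : R) (u : R -> R).
Local Notation leb := (@lebesgue_measure R).

(** With V the variation function of u, both V and V - u are nondecreasing and
    absolutely continuous, since the increments of u are dominated by those of V.
    The density of u is the difference of their densities. *)
Lemma abs_continuous_primitive a b u : a <= b -> abs_continuous a b u ->
  exists2 f : R -> R, leb.-integrable setT (EFin \o f) &
    forall x, a <= x -> x <= b ->
      u x - u a = (\int[leb]_(t in [set` `[a, x]]) f t)%R.
Proof.
move=> ab acu.
pose V := clamped_variation a b u.
pose W x := V x - u (clamp a b x).
have ndV : {homo V : x y / x <= y} by exact: clamped_variation_nondecreasing.
have acV : nondecreasing_ac V by exact: clamped_variation_ac.
have duV x y : x <= y -> `|u (clamp a b y) - u (clamp a b x)| <= V y - V x.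
  exact: clamped_variation_dominates.
have ndW : {homo W : x y / x <= y}.
  by move=> x y /duV; rewrite ler_norml /W => /andP[_ ?]; lra.
have acW : nondecreasing_ac W.
  move=> e e0; have [d d0 H] := acV (e / 2) (divr_gt0 e0 (ltr0Sn _ 1)).
  exists d => // s sp dis sd; have := H s sp dis sd.
  suff : \sum_(p <- s) (W p.2 - W p.1) <= 2 * \sum_(p <- s) (V p.2 - V p.1) by lra.
  rewrite mulr_sumr !big_seq; apply: ler_sum => p /(allP sp)/duV.
  by rewrite ler_norml /W => /andP[? _]; lra.
have [f1 if1 f1E] := nondecreasing_ac_density ab ndV acV.
have [f2 if2 f2E] := nondecreasing_ac_density ab ndW acW.
exists (f1 \- f2).
  rewrite (_ : _ \o _ = (EFin \o f1) \- (EFin \o f2))%E//.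
  exact: integrableB.
move=> x ax xb; rewrite RintegralB//; [|exact: integrableS if1|exact: integrableS if2].
by rewrite -f1E// -f2E// /W !clamp_id//; lra.
Qed.

(** Lebesgue differentiation for the primitive of f, which differs from u by a
    constant. *)
Lemma derive1_primitive_ae a b u (f : R -> R) :
  leb.-integrable setT (EFin \o f) ->
  (forall x, a <= x -> x <= b -> u x - u a = (\int[leb]_(t in [set` `[a, x]]) f t)%R) ->
  {ae leb, forall x, a < x -> x < b -> derive1 u x = f x}.
Proof.
move=> intf uE.
have intfy y : leb.-integrable [set` Interval (BLeft a) (BRight y)] (EFin \o f).
  exact: integrableS intf.
have := FTC1 intfy (open_integrable_locally openT intf).
apply: filterS; first exact: (ae_filter_ringOfSetsType leb).
move=> x /= H ax xb.
have {H}[|_ <-] := H; first by rewrite lte_fin.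
rewrite !derive1E; transitivity ('D_1 (fun y => u y - u a) x).
  have -> : (fun y => u y - u a) = (fun y => u y + - u a) by [].
  rewrite /derive; under [in RHS]eq_fun do rewrite opprD opprK addrACA addNr addr0.
  by [].
apply: near_eq_derive; near=> y; rewrite uE//.
- by apply/ltW; near: y; exact: lt_nbhsr.
- by apply/ltW; near: y; exact: lt_nbhsl.
Unshelve. all: by end_near. Qed.

Import HBNNSimple.

(** This compares the density of u with derive1 u, which coincide only almost
    everywhere. The integral of a nonnegative function is the supremum of the
    integrals of the simple functions below it, hence monotone; so it is enough to
    remove from A a null set outside of which f is below h. *)
Lemma ge0_le_integral_ae (A D : set (measurableTypeR R)) (f h : R -> \bar R) :
  measurable A -> A `<=` D -> measurable_fun A f ->
  (forall x, A x -> 0 <= f x)%E -> (forall x, D x -> 0 <= h x)%E ->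
  {ae leb, forall x, A x -> (f x <= h x)%E} ->
  (\int[leb]_(x in A) f x <= \int[leb]_(x in D) h x)%E.
Proof.
move=> mA AD mf f0 h0 [N [mN N0 subN]].
rewrite (ge0_negligible_integral mN)//.
rewrite !ge0_integralE//; last by move=> x [/f0].
apply: ereal_sup_le => _ [k kle <-] /=.
exists k => //= x.
apply: le_trans (kle x) _; rewrite /patch.
case: ifPn => [/set_mem[Ax Nx]|_]; last by case: ifPn => // /set_mem/h0.
rewrite mem_set; last exact: AD.
have : ~ (~ (A x -> (f x <= h x)%E)) by move=> /subN.
by move/contrapT; apply.
Qed.

Lemma integral_inv_sqr a b : 0 < a -> a < b ->
  (\int[leb]_(x in [set` `[a, b]]) ((x ^+ 2)^-1)%:E = (a^-1 - b^-1)%:E)%E.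
Proof.
move=> a0 ab.
have dF (x : R) : x != 0 -> is_derive x 1 (fun y : R => - y^-1) ((x ^+ 2)^-1).
  move=> x0; have -> : (x ^+ 2)^-1 = - (- x ^- 2 *: 1) :> R.
    by rewrite scaleNr opprK; exact/esym/mulr1.
  by apply: is_deriveN; exact: is_deriveV.
have cF (x : R) : x != 0 -> {for x, continuous (fun y : R => - y^-1)}.
  by move=> x0; apply: cvgN; exact: inv_continuous.
have n0 (x : R) : a <= x -> x != 0 by move=> ax; rewrite gt_eqF//; lra.
rewrite (@continuous_FTC2 _ _ (fun y : R => - y^-1) _ _ ab).
- by rewrite -EFinB opprK addrC.
- apply: continuous_in_subspaceT => x; rewrite inE/= in_itv/= => /andP[/n0 x0 _].
  apply: cvgV; first by rewrite expf_neq0.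
  exact: exprn_continuous.
- split.
  + move=> x; rewrite in_itv/= => /andP[/ltW/n0 x0 _].
    by have [] := dF _ x0.
  + by apply: cvg_at_right_filter; apply: cF; exact: n0.
  + by apply: cvg_at_left_filter; apply: cF; apply: n0; exact: ltW.
- move=> x; rewrite in_itv/= => /andP[/ltW/n0 x0 _].
  by rewrite derive1E; have /@derive_val := dF _ x0.
Qed.

End FundamentalTheorem.

(** * Pointwise decay of functions of finite Bessel energy *)

Section PointwiseBound.
Context {R : realType}.
Implicit Types (a b : R) (u v : R -> R).
Local Notation leb := (@lebesgue_measure R).

(** This is the Cauchy-Schwarz inequality for the product of f x, with f = u', and
    1 / x over ]a, b[, where x ^- 2 has integral 1 / a - 1 / b. It is stated with
    a free weight t, through the inequality
    |f| <= t / 2 * f ^+ 2 * x ^+ 2 + (2 * t)^-1 * x ^- 2, so that only integrals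
    of nonnegative functions occur. *)
Lemma energy_increment u a b t M : 0 < a -> a < b -> 0 < t ->
  loc_abs_continuous u -> (bessel_energy u <= M%:E)%E ->
  `|u b - u a| <= t / 2 * M + (2 * t)^-1 * a^-1.
Proof.
move=> a0 ab t0 acu uM.
have [f intf uE] := abs_continuous_primitive (ltW ab) (acu _ _ a0 (ltW ab)).
have mfT : measurable_fun setT f.
  by move/integrableP : (intf) => [/measurable_EFinP].
have mf : measurable_fun (`]a, b[ : set R) f by exact: measurable_funTS.
have mfx : measurable_fun (`]a, b[ : set R) (fun x : R => f x ^+ 2 * x ^+ 2).
  by apply: measurable_funM; apply: measurable_funX.
have mx : measurable_fun (`]a, b[ : set R) (fun x : R => (x ^+ 2)^-1).
  apply: open_continuous_measurable_fun; first exact: interval_open.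
  move=> x; rewrite inE/= in_itv/= => /andP[ax _].
  apply: cvgV; last exact: exprn_continuous.
  by rewrite expf_neq0// gt_eqF//; lra.
have main : (\int[leb]_(x in `]a, b[) (f x ^+ 2 * x ^+ 2)%:E <= M%:E)%E.
  apply: le_trans uM; apply: ge0_le_integral_ae => //.
  - by move=> x /=; rewrite /halfline/= !in_itv/= andbT => /andP[? _]; lra.
  - exact/measurable_EFinP.
  - by move=> x _; rewrite lee_fin mulr_ge0// sqr_ge0.
  - by move=> x _; rewrite lee_fin mulr_ge0// sqr_ge0.
  - have := derive1_primitive_ae intf uE.
    apply: filterS; first exact: (ae_filter_ringOfSetsType leb).
    by move=> x /= H; rewrite in_itv/= => /andP[/H] + /[dup] => /[apply] ->.
pose k1 x : \bar R := ((t / 2)%:E * (f x ^+ 2 * x ^+ 2)%:E)%E.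
pose k2 x : \bar R := ((2 * t)^-1%:E * ((x ^+ 2)^-1)%:E)%E.
have t20 : 0 <= t / 2 by lra.
have tV0 : 0 <= (2 * t)^-1 by rewrite invr_ge0; lra.
have fk x : x \in `]a, b[ -> (`|(f x)%:E| <= k1 x + k2 x)%E.
  rewrite in_itv/= => /andP[ax _]; rewrite /k1 /k2 -!EFinM -EFinD lee_fin.
  (* the difference of the two sides is a square *)
  rewrite -subr_ge0 (_ : _ - _ =
    (2 * t * x ^+ 2)^-1 * (`|f x| * t * x ^+ 2 - 1) ^+ 2); last first.
    rewrite -[f x ^+ 2]real_normK ?num_real//.
    by field; rewrite !gt_eqF//; lra.
  by rewrite mulr_ge0 ?sqr_ge0// invr_ge0 !mulr_ge0 ?sqr_ge0//; lra.
rewrite uE ?(ltW ab)//.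
rewrite /Rintegral (integral_itv_bndoo true false); last exact/measurable_EFinP.
have fin : (\int[leb]_(x in `]a, b[) (f x)%:E)%E \is a fin_num.
  by apply: integrable_fin_num => //; exact: integrableS intf.
rewrite -lee_fin -abse_EFin fineK//.
apply: (le_trans (le_abse_integral leb _ _)) => //; first exact/measurable_EFinP.
apply: (@le_trans _ _ (\int[leb]_(x in `]a, b[) (k1 x + k2 x))%E).
  apply: ge0_le_integral => //.
  - by apply: measurableT_comp => //; exact/measurable_EFinP.
  - apply: emeasurable_funD.
      by apply: measurable_funeM; exact/measurable_EFinP.
    by apply: measurable_funeM; exact/measurable_EFinP.
rewrite ge0_integralD//; last first.
- by apply: measurable_funeM; exact/measurable_EFinP.
- by move=> x _; rewrite mule_ge0 ?lee_fin// invr_ge0 sqr_ge0.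
- by apply: measurable_funeM; exact/measurable_EFinP.
- by move=> x _; rewrite mule_ge0 ?lee_fin// mulr_ge0 ?sqr_ge0.
rewrite EFinD; apply: leeD.
- rewrite ge0_integralZl_EFin//; first by rewrite [leRHS]EFinM lee_wpmul2l// lee_fin.
  + by move=> x _; rewrite lee_fin mulr_ge0// sqr_ge0.
  + exact/measurable_EFinP.
- rewrite ge0_integralZl_EFin//.
  + rewrite -(integral_itv_bndoo true false); last exact/measurable_EFinP.
    rewrite integral_inv_sqr// -EFinM lee_fin ler_wpM2l// gerBl invr_ge0; lra.
  + by move=> x _; rewrite lee_fin invr_ge0 sqr_ge0.
  + exact/measurable_EFinP.
Qed.

(** A function of absolute value at least e near +oo has infinite norm in
    L^2(m), since 2 * x ^+ 2 dx has infinite mass there. *)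
Lemma L2m_arbitrarily_small u a e : L2m u -> 0 < a -> 0 < e ->
  exists2 b, a < b & `|u b| < e.
Proof.
move=> [_ uoo] a0 e0; apply: contrapT => H.
have ue b : a < b -> e <= `|u b|.
  by move=> ab; rewrite leNgt; apply/negP => ub; apply: H; exists b.
move: uoo; apply/negP; rewrite -leNgt.
have -> : +oo%E = (\int[leb]_(x in [set` `]a, +oo[]) (e ^+ 2 * (2 * a ^+ 2))%:E)%E.
  rewrite integral_cst//= lebesgue_measure_itv/= ltry.
  by rewrite gt0_muley// lte_fin !mulr_gt0// exprn_gt0.
apply: ge0_le_integral_ae => //.
- by move=> x /=; rewrite /halfline/= !in_itv/= !andbT => ?; lra.
- by move=> x _; rewrite lee_fin mulr_ge0 ?sqr_ge0// mulr_ge0// sqr_ge0.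
- by move=> x _; rewrite lee_fin mulr_ge0 ?sqr_ge0// mulr_ge0// sqr_ge0.
- apply: aeW => x /=; rewrite in_itv/= andbT => ax; rewrite lee_fin.
  apply: ler_pM; rewrite ?sqr_ge0 ?mulr_ge0 ?(ltW a0)//; last first.
    by rewrite ler_pM2l// ler_sqr ?nnegrE; lra.
  rewrite -[u x ^+ 2]real_normK ?num_real//.
  by rewrite ler_sqr ?nnegrE ?normr_ge0 ?(ltW e0)// ue.
Qed.

(** v tends to 0 along some sequence tending to +oo, so the increment bound passes
    to the value of v at x; it is then optimized over the weight t. *)
Lemma bessel_dom_bound v x M : bessel_dom v -> 0 < x -> 0 < M ->
  (bessel_energy v <= M%:E)%E -> `|v x| <= Num.sqrt M / Num.sqrt x.
Proof.
move=> [acv L2v _] x0 M0 vM.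
set p := Num.sqrt M; set q := Num.sqrt x.
have p0 : 0 < p by rewrite sqrtr_gt0.
have q0 : 0 < q by rewrite sqrtr_gt0.
apply/ler_addgt0Pr => e e0.
have [b xb vb] := L2m_arbitrarily_small L2v x0 e0.
(* the minimizer of t / 2 * M + (2 * t * x)^-1 *)
have t0 : 0 < (p * q)^-1 by rewrite invr_gt0 mulr_gt0.
have := energy_increment x0 xb t0 acv vM.
rewrite [leRHS](_ : _ = p / q); last first.
  rewrite -[M]sqr_sqrtr ?ltW// -[x]sqr_sqrtr ?ltW// -/p -/q.
  by field; rewrite !gt_eqF.
have := ler_normB (v b) (v b - v x); rewrite opprB addrC subrK.
lra.
Qed.

End PointwiseBound.

(** * The trace form *)

Section TraceBound.
Context {R : realType}.
Variable a : nat -> R.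

Lemma limn_esup_lt (F : nat -> \bar R) y : (limn_esup F < y)%E ->
  exists n, forall m, (n <= m)%N -> (F m < y)%E.
Proof.
rewrite limn_esup_lim => Fy; apply: contrapT => H.
move: Fy; apply/negP; rewrite -leNgt; apply: lime_ge; first exact: is_cvg_esups.
apply: nearW => n; rewrite leNgt; apply/negP => ny; apply: H; exists n => m nm.
by apply: le_lt_trans ny; apply: ereal_sup_ubound; exists m.
Qed.

Lemma norm2_coordinate (ha : forall k, 0 < a k) (un : nat -> nat -> R)
    (u : nat -> R) k e :
  l2_strong_cvg a un u -> 0 < e ->
  exists n, forall m, (n <= m)%N -> `|u k - un m k| < e.
Proof.
move=> /fine_cvgP[finn cvn] e0.
have ake : 0 < a k * e ^+ 2 by rewrite mulr_gt0// exprn_gt0.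
have : \forall n \near \oo, (norm2 a (fun k => un n k - u k)%R < (a k * e ^+ 2)%:E)%E.
  near=> n; rewrite -[ltLHS]fineK; last by near: n.
  by rewrite lte_fin; near: n; exact: cvgr_lt cvn _ ake.
move=> [n _ H]; exists n => m /H /= nm.
have term : (((a k * (un m k - u k) ^+ 2)%R)%:E <= norm2 a (fun k => un m k - u k)%R)%E.
  have ge0 i : (0 <= ((a i * (un m i - u i) ^+ 2)%R)%:E)%E.
    by rewrite lee_fin mulr_ge0 ?sqr_ge0// ltW.
  rewrite /norm2; apply: le_trans (nneseries_lim_ge k.+1 _) => //.
  by rewrite big_nat_recr//= leeDr// sume_ge0.
have := le_lt_trans term nm; rewrite lte_fin ltr_pM2l// distrC => sq.
by rewrite -ltr_sqr ?nnegrE ?real_normK ?num_real// ltW.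
Unshelve. all: by end_near. Qed.

Lemma bessel_energy_ge0 (v : R -> R) : (0 <= bessel_energy v)%E.
Proof. by apply: integral_ge0 => x _; rewrite lee_fin mulr_ge0// sqr_ge0. Qed.

Lemma bessel_energy_le_lam (lam : R) (v : R -> R) : 0 <= lam ->
  (bessel_energy v <= bessel_energy_lam lam v)%E.
Proof.
move=> lam0; rewrite leeDl// mule_ge0 ?lee_fin//.
by apply: integral_ge0 => x _; rewrite lee_fin mulr_ge0 ?sqr_ge0// mulr_ge0// sqr_ge0.
Qed.

Lemma trace_form_lam_ge0 (lam : R) (s : nat -> R) : 0 <= lam ->
  (0 <= trace_form_lam a lam s)%E.
Proof.
move=> lam0; apply: le_ereal_inf_tmp => _ [u [v [_ _ _ ->]]].
by rewrite (le_trans (bessel_energy_ge0 v))// bessel_energy_le_lam.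
Qed.

(** A value of the trace form below M is attained on some v in the form domain
    which interpolates s at the positive integers and has energy below M. *)
Lemma trace_form_lam_bound (lam : R) (s : nat -> R) M k : 0 <= lam -> 0 < M ->
  (trace_form_lam a lam s < M%:E)%E ->
  `|s k| <= Num.sqrt M / Num.sqrt k.+1%:R.
Proof.
move=> lam0 M0 /ereal_inf_lt[_ [u [v [_ <- [domv _ [_ uv]] ->]]] vM].
have <- : v k.+1%:R = restrN u k.
  by apply/esym/eqP; rewrite -subr_eq0; apply/eqP; exact: uv.
apply: bessel_dom_bound => //.
exact: le_trans (bessel_energy_le_lam v lam0) (ltW vM).
Qed.

End TraceBound.

Theorem proposition3p9 (R : realType) (a : nat -> R) (ha : forall k, 0 < a k)
    (E : (nat -> R) -> \bar R) (hE : is_trace_form a E) :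
  exists2 c : R, 0 < c &
    forall (k : nat) (u : nat -> R), form_dom a E u ->
      `|u k| <= c / Num.sqrt (k.+1%:R) * Num.sqrt (fine (E u)).
Proof.
exists 1 => // k u [l2u Eu]; rewrite mul1r.
pose lam n : R := n.+1%:R^-1.
have lam0 n : 0 < lam n by rewrite invr_gt0.
have [_ /(_ u l2u)[un [_ unu unE]]] := hE lam lam0 (@cvg_harmonic R).
have E0 : (0 <= E u)%E.
  apply: le_trans unE; rewrite limn_esup_lim; apply: lime_ge.
    exact: is_cvg_esups.
  apply: nearW => n; apply: (@le_trans _ _ (trace_form_lam a (lam n) (un n))).
    exact/trace_form_lam_ge0/ltW.
  by apply: ereal_sup_ubound; exists n => /=.
have EK : E u = (fine (E u))%:E by rewrite fineK// ge0_fin_numE.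
have r0 : 0 <= fine (E u) by exact: fine_ge0.
set r := fine (E u) in EK r0 *.
set q := Num.sqrt k.+1%:R.
have q0 : 0 < q by rewrite sqrtr_gt0.
(* the recovery sequence un has trace energies eventually below any M > E u,
   so the uniform pointwise bound for these energies passes to the limit *)
have bound M : r < M -> `|u k| * q <= Num.sqrt M.
  move=> rM; rewrite -ler_pdivlMr//; apply/ler_addgt0Pr => e e0.
  have [n1 H1] : exists n, forall m, (n <= m)%N ->
      (trace_form_lam a (lam m) (un m) < M%:E)%E.
    by apply: limn_esup_lt; apply: le_lt_trans unE _; rewrite EK lte_fin.
  have [n2 H2] := norm2_coordinate ha k unu e0.
  have /ltW := H2 _ (leq_maxr n1 n2).
  have := trace_form_lam_bound k (ltW (lam0 _)) (le_lt_trans r0 rM)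
    (H1 _ (leq_maxl n1 n2)).
  set m := maxn n1 n2; rewrite -/q => b1 b2.
  by rewrite -[u k](subrK (un m k)) (le_trans (ler_normD _ _))// addrC lerD.
rewrite ler_pdivlMl// mulrC.
rewrite -[leLHS]ger0_norm ?mulr_ge0 ?(ltW q0)// -sqrtr_sqr ler_wsqrtr//.
apply/ler_addgt0Pr => e e0.
have rM : r < r + e by rewrite ltrDl.
rewrite -[leRHS]sqr_sqrtr; last by rewrite (le_trans r0)// ltW.
by rewrite ler_sqr ?nnegrE ?sqrtr_ge0 ?mulr_ge0 ?(ltW q0)// bound.
Qed.
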